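(* Let $M$ be a positive definite symmetric real $2n\times2n$ matrix, and let $X:=JM$. The eigenvalues of $X$ are of the form $\pm i\lambda_j$ with $\lambda_j>0$, $j=1,\dots,n$, and the associated eigenvectors can be written as $e_j\pm if_j$ with $e_j,f_j\in\mathbb{R}^{2n}$, that is, $X(e_j\pm if_j)=\pm i\lambda_j(e_j\pm if_j)$, so that $\{e_j,f_j\}_{j=1}^n$ forms a symplectic basis of $\mathbb{R}^n\times\mathbb{R}^n$. Then for the matrix with columns $$S:=\left(e_1|\dots|e_n\ \big|\ f_1|\dots|f_n\right)\in\mathrm{Sp}(2n,\mathbb{R}),$$ one has, for every $t\in\mathbb{R}$, $$\exp(tX)=J(S^{-1})^T\begin{pmatrix}\Theta&-\Omega\\\Omega&\Theta\end{pmatrix}S^{-1},$$ where $\Theta:=\mathrm{diag}(\sin(\lambda_jt))$ and $\Omega:=\mathrm{diag}(\cos(\lambda_jt))$ are $n\times n$ diagonal matrices.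
   Context: $J=\begin{pmatrix}0&I\\-I&0\end{pmatrix}$ is the standard $2n\times2n$ symplectic matrix, and $\mathrm{Sp}(2n,\mathbb{R})$ is the group of real $2n\times2n$ matrices $S$ with $S^TJS=J$. The standard symplectic form is $\sigma(z,z')=\langle Jz,z'\rangle$. A basis $\{e_j,f_j\}_{j=1}^n$ of $\mathbb{R}^n\times\mathbb{R}^n$ is a symplectic basis if $\sigma(e_j,e_k)=0$, $\sigma(f_j,f_k)=0$ and $\sigma(e_j,f_k)=-\delta_{jk}$ for all $j,k=1,\dots,n$. *)

(* Defs.v *)
From mathcomp Require Import all_boot all_order all_algebra.
From mathcomp Require Import complex.
From mathcomp Require Import all_classical all_reals all_analysis.

Set Implicit Arguments.
Unset Strict Implicit.
Unset Printing Implicit Defensive.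

Import Order.TTheory GRing.Theory Num.Theory numFieldNormedType.Exports.

Local Open Scope ring_scope.

Definition Jmx (R : realType) (n : nat) : 'M[R]_(n + n) :=
  block_mx 0 1%:M (- 1%:M) 0.

Definition Sp (R : realType) (n : nat) : {pred 'M[R]_(n + n)} :=
  [pred S | S^T *m Jmx R n *m S == Jmx R n].

Arguments Sp : clear implicits.

Definition dotmx (R : realType) (m : nat) (x y : 'cV[R]_m) : R :=
  (x^T *m y) 0 0.

Definition sigma (R : realType) (n : nat) (z z' : 'cV[R]_(n + n)) : R :=
  dotmx (Jmx R n *m z) z'.

Definition symplectic_basis (R : realType) (n : nat)
    (e f : 'I_n -> 'cV[R]_(n + n)) : Prop :=
  [/\ basis_of fullv ([seq e j | j <- enum 'I_n] ++ [seq f j | j <- enum 'I_n]),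
      forall j k, sigma (e j) (e k) = 0,
      forall j k, sigma (f j) (f k) = 0 &
      forall j k, sigma (e j) (f k) = - (j == k)%:R].

Definition sym_posdef (R : realType) (m : nat) (M : 'M[R]_m) : Prop :=
  M^T = M /\ forall x : 'cV[R]_m, x != 0 -> 0 < dotmx x (M *m x).

Definition cplx_mx (R : realType) (m p : nat) (A : 'M[R]_(m, p)) : 'M[R[i]]_(m, p) :=
  map_mx (real_complex R) A.

(* Every complex eigenvalue of X is one of the +- i lam_j, and conversely.
   [eigenvalue] is defined through row eigenvectors, which does not affect the
   set of eigenvalues. *)
Definition spectrum_pm_i (R : realType) (n m : nat) (X : 'M[R]_m)
    (lam : 'I_n -> R) : Prop :=
  forall mu : R[i], eigenvalue (cplx_mx X) mu <->
    exists j, mu = 'i * (lam j)%:C%C \/ mu = - ('i * (lam j)%:C%C).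

Definition pm_i_eigenvectors (R : realType) (n m : nat) (X : 'M[R]_m)
    (lam : 'I_n -> R) (e f : 'I_n -> 'cV[R]_m) : Prop :=
  forall j,
    cplx_mx X *m (cplx_mx (e j) + 'i *: cplx_mx (f j)) =
      ('i * (lam j)%:C%C) *: (cplx_mx (e j) + 'i *: cplx_mx (f j)) /\
    cplx_mx X *m (cplx_mx (e j) - 'i *: cplx_mx (f j)) =
      - ('i * (lam j)%:C%C) *: (cplx_mx (e j) - 'i *: cplx_mx (f j)).

Definition cols_mx (R : realType) (n : nat) (e f : 'I_n -> 'cV[R]_(n + n)) :
    'M[R]_(n + n) :=
  row_mx (\matrix_(i, j) e j i 0) (\matrix_(i, j) f j i 0).

(* Convergence is in the product (entrywise) topology of 'M[R]_m; the series
   converges for every A, so the default value of [limn] is never used. *)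
Definition expmx (R : realType) (m : nat) (A : 'M[R]_m) : 'M[R]_m :=
  limn (series (fun k : nat => (k`!%:R)^-1 *: A ^+ k)).

(* Main.v *)
(* For the inner product x^T M y the matrix X = JM is skew.  The sigma-complement
   of a partial symplectic frame made of X-invariant planes is X-invariant, and
   a complex eigenvector of X in it has a purely imaginary nonzero eigenvalue;
   its real and imaginary parts, suitably signed and rescaled, extend the frame.
   For a complete frame S, X S = S G with G = [[0, L], [-L, 0]], so the spectrum
   is read off from G and the exponential series becomes, entry by entry, the
   cosine and sine series; J S^-T = S J brings the result to the stated form. *)
Require Import Defs.
From mathcomp Require Import all_boot all_order all_algebra.
From mathcomp Require Import complex ring lra.
From mathcomp Require Import all_classical all_reals all_analysis.

Import Order.TTheory GRing.Theory Num.Theory numFieldNormedType.Exports.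

Local Open Scope ring_scope.

(* [spectral.dotmx], on row vectors, would otherwise shadow it. *)
Local Notation dotmx := Defs.dotmx.

(** * Entrywise convergence of matrix sequences *)

Lemma cvg_mx {K : numFieldType} {m p : nat} (u : nat -> 'M[K]_(m, p)) (A : 'M[K]_(m, p)) :
  (forall i j, u k i j @[k --> \oo] --> A i j)%classic -> (u k @[k --> \oo] --> A)%classic.
Proof.
move=> uA P [Q QA QP].
have /= : (\forall k \near \oo, forall i j, Q i j (u k i j))%classic.
  apply: filter_forall => i; apply: filter_forall => j.
  exact: (uA i j _ (QA i j)).
by apply: filterS => k Qk; apply: QP.
Qed.

Lemma cvg_mulmx {K : numFieldType} {m p q : nat} (u : nat -> 'M[K]_(m, p))
    (v : nat -> 'M[K]_(p, q)) (A : 'M[K]_(m, p)) (B : 'M[K]_(p, q)) :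
  (u k @[k --> \oo] --> A)%classic -> (v k @[k --> \oo] --> B)%classic ->
  (u k *m v k @[k --> \oo] --> A *m B)%classic.
Proof.
move=> uA vB; apply: cvg_mx => i j; rewrite mxE.
under eq_fun do rewrite mxE.
apply: cvg_big => [|l _]; first exact: add_continuous.
apply: cvgM.
- apply: (cvg_comp u (fun M : 'M[K]_(m, p) => M i l)); [exact: uA | exact: coord_continuous].
- apply: (cvg_comp v (fun M : 'M[K]_(p, q) => M l j)); [exact: vB | exact: coord_continuous].
Qed.

(** * Eigenvectors in stable subspaces, and their real and imaginary parts *)

(** In the basis [row_base V] the restriction of [A] to [V] is a matrix of positive size, so it has
    an eigenvalue over a closed field; its eigenvector is carried back to [V]. *)
Lemma stablemx_eigenvector {C : numClosedFieldType} {m : nat} (V A : 'M[C]_m) :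
  stablemx V A -> V != 0 ->
  exists v : 'rV_m, exists mu, [/\ v != 0, (v <= V)%MS & v *m A = mu *: v].
Proof.
move=> VA V0; have rV : (0 < \rank V)%N by rewrite lt0n mxrank_eq0.
have [mu /eigenvalueP[u uA u0]] := eigenvalue_closed (conjmx (row_base V) A) rV.
exists (u *m row_base V), mu; split.
- by rewrite mulmx_free_eq0 ?row_base_free.
- by rewrite mulmx_sub // eq_row_base.
- apply/eigenspaceP; rewrite -sub_eigenspace_conjmx ?stablemx_row_base ?row_base_free //.
  exact/eigenspaceP.
Qed.

Lemma cplx_mx_inj {R : realType} {m p : nat} (A B A' B' : 'M[R]_(m, p)) :
  cplx_mx A + 'i *: cplx_mx B = cplx_mx A' + 'i *: cplx_mx B' ->
  A = A' /\ B = B'.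
Proof.
move=> /matrixP E; split; apply/matrixP => i j; move: (E i j); rewrite !mxE.
all: by rewrite -!complexiE /real_complex_def /=; simpc => -[].
Qed.

Lemma cplx_mxE {R : realType} {m p : nat} (z : 'M[R[i]]_(m, p)) :
  z = cplx_mx (map_mx (@complex.Re R) z) + 'i *: cplx_mx (map_mx (@complex.Im R) z).
Proof. by apply/matrixP => i j; rewrite !mxE; rewrite -complexiE [LHS]complexE. Qed.

Lemma cplx_mulmx {R : realType} {m p : nat} (A : 'M[R]_m) (a b : 'M[R]_(m, p)) :
  cplx_mx A *m (cplx_mx a + 'i *: cplx_mx b) =
  cplx_mx (A *m a) + 'i *: cplx_mx (A *m b).
Proof. by rewrite mulmxDr -scalemxAr /cplx_mx !map_mxM. Qed.

Lemma cplx_scale {R : realType} {m p : nat} (x y : R) (a b : 'M[R]_(m, p)) :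
  (x%:C + 'i * y%:C)%C *: (cplx_mx a + 'i *: cplx_mx b) =
  cplx_mx (x *: a - y *: b) + 'i *: cplx_mx (y *: a + x *: b).
Proof.
apply/matrixP => i j; rewrite !mxE -!complexiE /real_complex_def /=; simpc.
by congr (_ +i* _)%C; ring.
Qed.

(** [B *m X = D *m B] makes the kernel of [B] stable under [X], and [p < m] makes it nonzero;
    [a + i b] is a complex eigenvector in it, with eigenvalue [x + i y]. *)
Lemma real_invariant_pair {R : realType} {m p : nat} (X : 'M[R]_m)
    (B : 'M[R]_(p, m)) (D : 'M[R]_p) : B *m X = D *m B -> (p < m)%N ->
  exists (a b : 'cV[R]_m) (x y : R),
    [/\ (a != 0) || (b != 0), B *m a = 0, B *m b = 0,
        X *m a = x *: a - y *: b & X *m b = y *: a + x *: b].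
Proof.
move=> BX pm; pose V := kermx (cplx_mx B)^T.
have VX : stablemx V (cplx_mx X)^T.
  apply/sub_kermxP; rewrite -mulmxA -trmx_mul /cplx_mx -map_mxM BX map_mxM.
  by rewrite trmx_mul mulmxA mulmx_ker mul0mx.
have V0 : V != 0.
  rewrite -mxrank_eq0 mxrank_ker subn_eq0 -ltnNge.
  by rewrite (leq_ltn_trans (rank_leq_col _)).
have [v [mu [v0 /sub_kermxP vB vX]]] := stablemx_eigenvector _ _ VX V0.
pose a := map_mx (@complex.Re R) v^T; pose b := map_mx (@complex.Im R) v^T.
have vE : v^T = cplx_mx a + 'i *: cplx_mx b by exact: cplx_mxE.
exists a, b, (complex.Re mu), (complex.Im mu).
have [Ba Bb] : B *m a = 0 /\ B *m b = 0.
  apply: cplx_mx_inj.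
  rewrite /cplx_mx !map_mxM map_mx0 scaler0 addr0 scalemxAr -mulmxDr -[LHS]trmxK.
  by rewrite -vE trmx_mul trmxK vB trmx0.
have [Xa Xb] : X *m a = complex.Re mu *: a - complex.Im mu *: b /\
               X *m b = complex.Im mu *: a + complex.Re mu *: b.
  apply: cplx_mx_inj; rewrite -cplx_mulmx -cplx_scale -vE.
  rewrite -[cplx_mx X]trmxK -trmx_mul vX linearZ /=; congr (_ *: _).
  by rewrite [LHS]complexE complexiE.
split=> //; apply: contraNT v0; rewrite negb_or !negbK => /andP[/eqP a0 /eqP b0].
by rewrite -[v]trmxK vE a0 b0 /cplx_mx map_mx0 scaler0 addr0 trmx0.
Qed.

(** * The inner product, [J] and the symplectic form *)

Lemma dotmxC {R : realType} {m : nat} (u v : 'cV[R]_m) : dotmx u v = dotmx v u.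
Proof. by rewrite /dotmx -[u^T *m v]trmxK trmx_mul trmxK mxE. Qed.

Lemma dotmxDl {R : realType} {m : nat} (u v w : 'cV[R]_m) :
  dotmx (u + v) w = dotmx u w + dotmx v w.
Proof. by rewrite /dotmx linearD mulmxDl mxE. Qed.

Lemma dotmxZl {R : realType} {m : nat} c (u v : 'cV[R]_m) :
  dotmx (c *: u) v = c * dotmx u v.
Proof. by rewrite /dotmx linearZ -scalemxAl mxE. Qed.

Lemma dotmxNl {R : realType} {m : nat} (u v : 'cV[R]_m) :
  dotmx (- u) v = - dotmx u v.
Proof. by rewrite -scaleN1r dotmxZl mulN1r. Qed.

Lemma dotmxZr {R : realType} {m : nat} c (u v : 'cV[R]_m) :
  dotmx u (c *: v) = c * dotmx u v.
Proof. by rewrite dotmxC dotmxZl dotmxC. Qed.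

Lemma dotmx_mull {R : realType} {m : nat} (A : 'M[R]_m) (u v : 'cV[R]_m) :
  dotmx (A *m u) v = dotmx u (A^T *m v).
Proof. by rewrite /dotmx trmx_mul mulmxA. Qed.

Lemma Jmx_tr {R : realType} n : (Jmx R n)^T = - Jmx R n.
Proof.
by rewrite /Jmx tr_block_mx !trmx0 trmx1 opp_block_mx !oppr0 opprK linearN /= trmx1.
Qed.

Lemma Jmx_sqr {R : realType} n : Jmx R n *m Jmx R n = - 1%:M.
Proof.
rewrite /Jmx mulmx_block !(mul0mx, mulmx0, mulmx1, mul1mx, mulmxN, mulNmx).
by rewrite !(addr0, add0r) scalar_mx_block opp_block_mx oppr0.
Qed.

Lemma sigmaC {R : realType} {n : nat} (u v : 'cV[R]_(n + n)) :
  sigma u v = - sigma v u.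
Proof. by rewrite /sigma dotmx_mull dotmxC Jmx_tr mulNmx dotmxNl. Qed.

Lemma sigma_alt {R : realType} {n : nat} (u : 'cV[R]_(n + n)) : sigma u u = 0.
Proof. by have := sigmaC u u; lra. Qed.

(** * Inductive construction of the symplectic frame *)

Section Hamiltonian.
Context {R : realType} {n : nat} (M : 'M[R]_(n + n)) (hM : sym_posdef M).
Let J := Jmx R n.
Let X := J *m M.

Lemma posdef_ge0 (a : 'cV[R]_(n + n)) : 0 <= dotmx a (M *m a).
Proof.
have [->|a0] := eqVneq a 0; first by rewrite mulmx0 /dotmx mulmx0 mxE.
by apply/ltW; case: hM => _ /(_ a a0).
Qed.

(** Each side pairs [M *m a] and [M *m b] through [J], so this is the antisymmetry of [J]. *)
Lemma hamiltonian_skew (a b : 'cV[R]_(n + n)) :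
  dotmx (X *m a) (M *m b) = - dotmx (X *m b) (M *m a).
Proof.
rewrite /X -!mulmxA dotmx_mull Jmx_tr mulNmx dotmxC dotmxNl; congr (- _).
Qed.

Lemma posdef_sym (a b : 'cV[R]_(n + n)) : dotmx a (M *m b) = dotmx b (M *m a).
Proof. by rewrite dotmxC dotmx_mull (proj1 hM). Qed.

Lemma hamiltonian_J (a : 'cV[R]_(n + n)) : M *m a = - (J *m (X *m a)).
Proof. by rewrite /X /J !mulmxA Jmx_sqr mulNmx mul1mx mulNmx opprK. Qed.

(* Skewness of [X] for the inner product given by [M] forces an invariant pair
   to rotate, without dilation. *)
Lemma symplectic_normalization (a b : 'cV[R]_(n + n)) (x y : R) :
  (a != 0) || (b != 0) ->
  X *m a = x *: a - y *: b -> X *m b = y *: a + x *: b ->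
  exists (c d lam : R), let e := c *: a in let f := d *: b in
    [/\ 0 < lam, X *m e = - lam *: f, X *m f = lam *: e & sigma e f = -1].
Proof.
move=> ab0 Xa Xb.
(* With [al], [be], [ga] as set below, these give [x * al = y * ga], [x * be = - y * ga] and, once
   [x = 0], [y * al = y * be]. *)
have haa := hamiltonian_skew a a; have hbb := hamiltonian_skew b b.
have hab := hamiltonian_skew a b.
rewrite ?Xa ?Xb !(dotmxDl, dotmxNl, dotmxZl) in haa hbb hab.
rewrite (posdef_sym b a) in haa hab.
have a_ge0 := posdef_ge0 a; have b_ge0 := posdef_ge0 b.
have ab_gt0 : 0 < dotmx a (M *m a) + dotmx b (M *m b).
  case/orP: ab0 => /(proj2 hM) h; lra.
set al := dotmx a (M *m a) in haa hbb hab a_ge0 b_ge0 ab_gt0 *.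
set be := dotmx b (M *m b) in haa hbb hab a_ge0 b_ge0 ab_gt0 *.
set ga := dotmx a (M *m b) in haa hbb hab.
have x0 : x = 0.
  have : x * (al + be) = 0 by lra.
  by move/eqP; rewrite mulf_eq0 (gt_eqF ab_gt0) orbF => /eqP.
(* If [x = y = 0], then [X], and hence [M = - J X], kills [a] and [b], against [ab_gt0]. *)
have y0 : y != 0.
  apply/eqP => y0; move: Xa Xb; rewrite x0 y0 !scale0r subr0 addr0 => Xa Xb.
  by move: ab_gt0; rewrite /al /be !hamiltonian_J Xa Xb !mulmx0 oppr0 /dotmx
    !mulmx0 mxE addr0 ltxx.
have albe : al = be by apply: (mulfI y0); rewrite x0 in hab; lra.
have al0 : 0 < al by lra.
have lam0 : 0 < `|y| by rewrite normr_gt0.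
(* Since [|y| sigma e f = - dotmx e (M e) = - c^2 al], this scale yields [sigma e f = -1]; the sign
   of [y] goes into [f], so that [lam = |y|] is positive. *)
pose c := Num.sqrt (`|y| / al).
have c2 : c ^+ 2 = `|y| / al by rewrite sqr_sqrtr // divr_ge0 // ltW.
exists c, (c * Num.sg y), `|y|.
have Xe : X *m (c *: a) = - `|y| *: ((c * Num.sg y) *: b).
  rewrite -scalemxAr Xa x0 scale0r add0r scalerN scaleNr !scalerA; congr (- (_ *: _)).
  by rewrite mulrCA [_ * Num.sg y]mulrC -numEsg.
split=> //.
  rewrite -scalemxAr Xb x0 scale0r addr0 !scalerA; congr (_ *: _).
  by rewrite -mulrA -normrEsg mulrC.
have : `|y| * sigma (c *: a) ((c * Num.sg y) *: b) = - dotmx (c *: a) (M *m (c *: a)).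
  rewrite [M *m _]hamiltonian_J Xe -scalemxAr scaleNr opprK dotmxZr.
  by rewrite [in RHS]dotmxC -/(sigma _ _) [in RHS]sigmaC; ring.
rewrite -scalemxAr dotmxZl dotmxZr mulrA -expr2 c2 -/al divfK ?gt_eqF // => h.
by apply: (mulfI (lt0r_neq0 lam0)); rewrite h mulrN1.
Qed.

(** Families are indexed by [nat], constrained only below [k], so that a frame is extended without a
    change of type. *)
Definition symplectic_upto (k : nat) (lam : nat -> R) (e f : nat -> 'cV[R]_(n + n)) :=
  (forall j, (j < k)%N ->
     [/\ 0 < lam j, X *m e j = - lam j *: f j & X *m f j = lam j *: e j]) /\
  (forall j l, (j < k)%N -> (l < k)%N ->
     [/\ sigma (e j) (e l) = 0, sigma (f j) (f l) = 0 &
         sigma (e j) (f l) = - (j == l)%:R]).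

(** Its kernel is the symplectic complement of the first [k] vectors [g j]. *)
Definition sigma_rows (k : nat) (g : nat -> 'cV[R]_(n + n)) : 'M[R]_(k, n + n) :=
  \matrix_(j, i) (J *m g j) i 0.

Lemma sigma_rows_mul k g (w : 'cV[R]_(n + n)) (j : 'I_k) :
  (sigma_rows k g *m w) j 0 = sigma (g j) w.
Proof. by rewrite /sigma /dotmx !mxE; apply: eq_bigr => i _; rewrite !mxE. Qed.

(** [X] is skew for [sigma], since [X^T J = M = - J X]; hence the minus sign. *)
Lemma sigma_rows_hamiltonian k (lam : nat -> R) g h :
  (forall j, (j < k)%N -> X *m g j = lam j *: h j) ->
  sigma_rows k g *m X = diag_mx (\row_j - lam j) *m sigma_rows k h.
Proof.
move=> Xg; apply/row_matrixP => j; rewrite !row_mul row_diag_mx -scalemxAl -rowE !mxE.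
have rowJ g' : row j (sigma_rows k g') = (J *m g' j)^T.
  by apply/rowP => i; rewrite !mxE.
rewrite !rowJ -[X]trmxK -trmx_mul; apply: trmx_inj; rewrite trmxK linearZ /= trmxK.
have -> : (X^T *m (J *m g j)) = M *m g j.
  rewrite /X trmx_mul (proj1 hM) Jmx_tr mulmxN mulNmx -mulmxA [J *m (J *m _)]mulmxA.
  by rewrite Jmx_sqr mulNmx mul1mx mulmxN opprK.
by rewrite hamiltonian_J Xg // -scalemxAr scaleNr.
Qed.

(** The complement of the frame is stable under [X] and cut out by [k + k < n + n] equations, so it
    contains an invariant pair, which after normalization takes index [k]. *)
Lemma symplectic_upto_succ k lam e f : (k < n)%N -> symplectic_upto k lam e f ->
  exists lam' e' f', symplectic_upto k.+1 lam' e' f'.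
Proof.
move=> kn [hX hs].
pose B := col_mx (sigma_rows k e) (sigma_rows k f).
(* Each block carries the minus sign of [sigma_rows_hamiltonian]; the second one in the upper block
   comes from [X *m e j = - lam j *: f j]. *)
pose D := block_mx 0 (diag_mx (\row_(j < k) - - lam j))
                   (diag_mx (\row_(j < k) - lam j)) 0 : 'M[R]_(k + k).
have BX : B *m X = D *m B.
  rewrite mul_block_col mul_col_mx !mul0mx add0r addr0.
  congr col_mx; [apply: (sigma_rows_hamiltonian _ (fun j => - lam j))
                |apply: sigma_rows_hamiltonian] => j jk; by case: (hX j jk).
have [|a [b [x [y [ab0 Ba Bb Xa Xb]]]]] := real_invariant_pair _ _ _ BX.
  exact: leq_add kn (ltnW kn).
have orth w : B *m w = 0 -> forall j, (j < k)%N -> sigma (e j) w = 0 /\ sigma (f j) w = 0.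
  rewrite mul_col_mx -[0]vsubmxK => /eq_col_mx[Ew Fw] j jk.
  by rewrite -(sigma_rows_mul k e w (Ordinal jk)) -(sigma_rows_mul k f w (Ordinal jk)) Ew Fw !mxE.
have [c [d [mu [mu0 Xe Xf ef]]]] := symplectic_normalization _ _ _ _ ab0 Xa Xb.
set e0 := c *: a in Xe Xf ef; set f0 := d *: b in Xe Xf ef.
have Be0 : B *m e0 = 0 by rewrite -scalemxAr Ba scaler0.
have Bf0 : B *m f0 = 0 by rewrite -scalemxAr Bb scaler0.
exists (fun j => if (j < k)%N then lam j else mu),
       (fun j => if (j < k)%N then e j else e0),
       (fun j => if (j < k)%N then f j else f0).
split=> [j|j l] jk; first by case: ifP => jk'; [exact: hX | split].
rewrite !ltnS in jk * => lk.
(* Old with old, old with new, new with old, new with new; in the last case both indices equal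
   [k]. *)
case: ltnP => jk'; case: ltnP => lk'.
- exact: hs.
- have [e1 f1] := orth e0 Be0 j jk'; have [e2 f2] := orth f0 Bf0 j jk'.
  by rewrite e1 f2 e2 ltn_eqF ?oppr0 // (leq_trans jk').
- have [e1 f1] := orth e0 Be0 l lk'; have [e2 f2] := orth f0 Bf0 l lk'.
  rewrite sigmaC e1 [sigma f0 _]sigmaC f2 [sigma e0 _]sigmaC f1.
  by rewrite gtn_eqF ?oppr0 // (leq_trans lk').
- have -> : j = l by apply/eqP; rewrite eqn_leq (leq_trans jk lk') (leq_trans lk jk').
  by rewrite !sigma_alt eqxx ef.
Qed.

Lemma symplectic_upto_exists k : (k <= n)%N -> exists lam e f, symplectic_upto k lam e f.
Proof.
elim: k => [_|k IHk kn]; first by exists (fun=> 0), (fun=> 0), (fun=> 0).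
have [lam [e [f h]]] := IHk (ltnW kn).
exact: symplectic_upto_succ _ _ _ _ kn h.
Qed.

Lemma williamson_frame : exists (lam : 'I_n -> R) (e f : 'I_n -> 'cV[R]_(n + n)),
  [/\ forall j, 0 < lam j,
      forall j, X *m e j = - lam j *: f j /\ X *m f j = lam j *: e j,
      forall j k, sigma (e j) (e k) = 0,
      forall j k, sigma (f j) (f k) = 0 &
      forall j k, sigma (e j) (f k) = - (j == k)%:R].
Proof.
have [lam [e [f [hX hs]]]] := symplectic_upto_exists n (leqnn n).
by exists lam, e, f; split=> [j|j|j k|j k|j k]; case: (hX j (ltn_ord j)) => // *;
  case: (hs j k (ltn_ord j) (ltn_ord k)).
Qed.
End Hamiltonian.

(** * Real form of the complex eigenvector equations *)

(** The real equations are the real and imaginary parts of the one for [e + i f]; the one for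
    [e - i f] is its conjugate. *)
Lemma pm_i_eigenvectorsP {R : realType} {n m : nat} (X : 'M[R]_m)
    (lam : 'I_n -> R) (e f : 'I_n -> 'cV[R]_m) :
  pm_i_eigenvectors X lam e f <->
  forall j, X *m e j = - lam j *: f j /\ X *m f j = lam j *: e j.
Proof.
have iE (l : R) : 'i * l%:C%C = (0%:C + 'i * l%:C)%C :> R[i].
  by rewrite -complexiE /real_complex_def; simpc.
have niE (l : R) : - ('i * l%:C%C) = (0%:C + 'i * (- l)%:C)%C :> R[i].
  by rewrite -complexiE /real_complex_def; simpc.
split=> h j.
  have [+ _] := h j; rewrite cplx_mulmx iE cplx_scale => /cplx_mx_inj[-> ->].
  by rewrite !scale0r add0r addr0 scaleNr.
have [Xe Xf] := h j; split.
  by rewrite cplx_mulmx iE cplx_scale Xe Xf !scale0r add0r addr0 scaleNr.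
have -> : cplx_mx (e j) - 'i *: cplx_mx (f j) = cplx_mx (e j) + 'i *: cplx_mx (- f j).
  by rewrite /cplx_mx map_mxN scalerN.
rewrite niE cplx_mulmx cplx_scale mulmxN Xe Xf.
by rewrite !scale0r add0r addr0 scalerN !scaleNr opprK.
Qed.

(** * The matrix of a complete symplectic frame *)

Section Frame.
Context {R : realType} {n : nat} (e f : 'I_n -> 'cV[R]_(n + n)).
Context (ee : forall j k, sigma (e j) (e k) = 0).
Context (ff : forall j k, sigma (f j) (f k) = 0).
Context (ef : forall j k, sigma (e j) (f k) = - (j == k)%:R).
Let S := cols_mx e f.

Lemma gram_sigma (g h : 'I_n -> 'cV[R]_(n + n)) :
  (\matrix_(i, j) g j i 0)^T *m Jmx R n *m (\matrix_(i, j) h j i 0) =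
  \matrix_(j, k) - sigma (g j) (h k) :> 'M[R]_n.
Proof.
apply/matrixP => j k; rewrite [RHS]mxE /sigma dotmx_mull Jmx_tr mulNmx dotmxC dotmxNl.
rewrite opprK dotmxC /Defs.dotmx mulmxA !mxE; apply: eq_bigr => i _.
by rewrite !mxE; congr (_ * _); apply: eq_bigr => l _; rewrite !mxE.
Qed.

(** The four blocks are Gram matrices of [- sigma]; the sign in [ef] is what puts the identity in
    the upper right block. *)
Lemma frame_symplectic : S^T *m Jmx R n *m S = Jmx R n.
Proof.
rewrite /S /cols_mx tr_row_mx !mul_col_mx !mul_mx_row !gram_sigma -/(block_mx _ _ _ _).
congr block_mx; apply/matrixP => j k; rewrite !mxE.
- by rewrite ee oppr0.
- by rewrite ef opprK.
- by rewrite sigmaC ef !opprK eq_sym.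
- by rewrite ff oppr0.
Qed.

(** [S^T J S = J] and [J^2 = -1] give the left inverse [- J S^T J]. *)
Lemma frame_unit : S \in unitmx.
Proof.
suff : (- (Jmx R n *m S^T *m Jmx R n)) *m S = 1%:M by case/mulmx1_unit.
by rewrite mulNmx -!mulmxA [S^T *m _]mulmxA frame_symplectic Jmx_sqr opprK.
Qed.

(** Symplecticity gives [J S = S^-T J]; multiply by [J] on both sides and use [J^2 = -1]. *)
Lemma frame_J_inv_tr : Jmx R n *m (invmx S)^T = S *m Jmx R n.
Proof.
have JS : Jmx R n *m S = (invmx S)^T *m Jmx R n.
  have uST : S^T \in unitmx by rewrite unitmx_tr frame_unit.
  by rewrite -[in RHS]frame_symplectic trmx_inv -mulmxA mulKmx.
have -> : (invmx S)^T = - (Jmx R n *m S *m Jmx R n).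
  by rewrite JS -mulmxA Jmx_sqr mulmxN mulmx1 opprK.
by rewrite mulmxN !mulmxA Jmx_sqr !mulNmx mul1mx opprK.
Qed.

(** There are as many vectors as dimensions, so spanning suffices; the coordinates of [v] are the
    entries of [S^-1 v]. *)
Lemma frame_basis : symplectic_basis e f.
Proof.
split=> //; rewrite basisEdim size_cat !size_map -!enumT size_enum_ord dimvf /=.
rewrite /dim /= muln1 leqnn andbT; apply/subvP => v _.
rewrite -[v](mulKVmx frame_unit); set w := invmx S *m v.
rewrite -[w]vsubmxK /S /cols_mx mul_row_col.
have sum_cols (g : 'I_n -> 'cV[R]_(n + n)) (c : 'cV[R]_n) :
    (\matrix_(i, j) g j i 0) *m c = \sum_j c j 0 *: g j.
  apply/colP => i; rewrite mxE summxE; apply: eq_bigr => j _.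
  by rewrite !mxE mulrC.
rewrite !sum_cols span_cat; apply: memv_add; apply: memv_suml => j _;
  by apply/memvZ/memv_span/map_f; rewrite mem_enum.
Qed.

Context (lam : 'I_n -> R) (X : 'M[R]_(n + n)).
Context (XeXf : forall j, X *m e j = - lam j *: f j /\ X *m f j = lam j *: e j).

Lemma frame_intertwines :
  X *m S = S *m block_mx 0 (diag_mx (\row_j lam j)) (- diag_mx (\row_j lam j)) 0.
Proof.
rewrite /S /cols_mx mul_mx_row mul_row_block !mulmx0 addr0 add0r.
have colX (g h : 'I_n -> 'cV[R]_(n + n)) (c : 'I_n -> R) :
    (forall j, X *m g j = c j *: h j) ->
    X *m (\matrix_(i, j) g j i 0) = (\matrix_(i, j) h j i 0) *m diag_mx (\row_j c j).
  move=> Xg; apply/matrixP => i j; rewrite mul_mx_diag !mxE mulrC.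
  rewrite -[RHS]mulrC; have := congr1 (fun v : 'cV[R]_(n + n) => v i 0) (Xg j).
  rewrite !mxE mulrC => <-; by apply: eq_bigr => l _; rewrite !mxE.
congr row_mx; last by apply: colX => j; case: (XeXf j).
rewrite (colX e f (fun j => - lam j)); last by move=> j; case: (XeXf j).
rewrite mulmxN -mulNmx; apply/matrixP => i j; rewrite !mul_mx_diag !mxE.
by rewrite mulrN mulNr.
Qed.
End Frame.

(** * Spectrum by similarity to an antidiagonal block matrix *)

Lemma eigenvalue_similar {F : fieldType} {m : nat} (A B P : 'M[F]_m) mu :
  P \in unitmx -> A *m P = P *m B -> eigenvalue A mu = eigenvalue B mu.
Proof.
move=> uP AP; apply/eigenvalueP/eigenvalueP => -[v vA v0].
  exists (v *m P); first by rewrite -mulmxA -AP mulmxA vA scalemxAl.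
  by rewrite mulmx_free_eq0 // row_free_unit.
exists (v *m invmx P); last by rewrite mulmx_free_eq0 // row_free_unit unitmx_inv.
have -> : A = P *m B *m invmx P by rewrite -AP mulmxK.
by rewrite !mulmxA mulmxKV // vA scalemxAl.
Qed.

(** For a row [(x, y)] the eigenvector equations read [- y_j l_j = mu x_j] and [x_j l_j = mu y_j];
    they are combined at a nonzero coordinate. *)
Lemma eigenvalue_antidiag {F : fieldType} {n : nat} (l : 'I_n -> F) (mu : F) :
  (forall j, l j != 0) ->
  eigenvalue (block_mx 0 (diag_mx (\row_j l j)) (- diag_mx (\row_j l j)) 0) mu <->
  exists j, mu ^+ 2 = - l j ^+ 2.
Proof.
move=> l0; split=> [/eigenvalueP[w + w0]|[j muj]].
  move: w0; rewrite -[w]hsubmxK; move: (lsubmx w) (rsubmx w) => x y w0.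
  rewrite mul_row_block !mulmx0 add0r addr0 scale_row_mx mulmxN => /eq_row_mx[xE yE].
  have {}xE j : - (y 0 j * l j) = mu * x 0 j.
    by have /rowP/(_ j) := xE; rewrite mxE mul_mx_diag !mxE.
  have {}yE j : x 0 j * l j = mu * y 0 j.
    by have /rowP/(_ j) := yE; rewrite mul_mx_diag !mxE.
  have [j /orP nz] : exists j, (x 0 j != 0) || (y 0 j != 0).
    apply/existsP; apply: contraNT w0; rewrite negb_exists => /forallP xy0.
    rewrite -row_mx0; apply/eqP; congr row_mx; apply/rowP => j; rewrite !mxE;
      by have := xy0 j; rewrite negb_or !negbK => /andP[/eqP ? /eqP ?].
  exists j; case: nz => [x0|y0].
    apply: (mulIf x0); rewrite expr2 -mulrA -xE mulrN mulrA -yE; ring.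
  by apply: (mulIf y0); rewrite expr2 -mulrA -yE mulrA -xE; ring.
(* The choice [x_j = l_j] forces [y_j = - mu] by the first equation, and [l_j != 0] keeps the row
   nonzero. *)
apply/eigenvalueP; exists (row_mx (l j *: delta_mx 0 j) (- mu *: delta_mx 0 j)).
  rewrite mul_row_block !mulmx0 add0r addr0 scale_row_mx mulmxN.
  congr row_mx; apply/rowP => i; [rewrite mxE|]; rewrite mul_mx_diag !mxE eqxx /=;
    have [->|_] := eqVneq i j; rewrite ?mulr1 ?mulr0 ?mul0r ?oppr0 //; first by ring.
  by rewrite mulrN -[mu * mu]expr2 muj opprK expr2.
apply/eqP => /rowP/(_ (lshift n j)); rewrite row_mxEl !mxE !eqxx mulr1 => /eqP.
by rewrite (negbTE (l0 j)).
Qed.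

(** * Rotation blocks and the exponential series *)

(** Block encoding of the diagonal matrix with entries [c j + i s j]: sums and products follow
    complex arithmetic. *)
Definition rotation_mx {R : nzRingType} {n : nat} (c s : 'I_n -> R) : 'M[R]_(n + n) :=
  block_mx (diag_mx (\row_j c j)) (diag_mx (\row_j s j))
           (- diag_mx (\row_j s j)) (diag_mx (\row_j c j)).

Lemma rotation_mxD {R : nzRingType} {n : nat} (c s c' s' : 'I_n -> R) :
  rotation_mx c s + rotation_mx c' s' =
  rotation_mx (fun j => c j + c' j) (fun j => s j + s' j).
Proof.
rewrite /rotation_mx add_block_mx -opprD -!linearD /=.
have rowD (g h : 'I_n -> R) : \row_j g j + \row_j h j = \row_j (g j + h j).
  by apply/rowP => j; rewrite !mxE.
by rewrite !rowD.
Qed.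

Lemma rotation_mxZ {R : nzRingType} {n : nat} a (c s : 'I_n -> R) :
  a *: rotation_mx c s = rotation_mx (fun j => a * c j) (fun j => a * s j).
Proof.
rewrite /rotation_mx scale_block_mx scalerN -!linearZ /=.
have rowZ (g : 'I_n -> R) : a *: \row_j g j = \row_j (a * g j).
  by apply/rowP => j; rewrite !mxE.
by rewrite !rowZ.
Qed.

Lemma rotation_mxM {R : comNzRingType} {n : nat} (c s c' s' : 'I_n -> R) :
  rotation_mx c s *m rotation_mx c' s' =
  rotation_mx (fun j => c j * c' j - s j * s' j) (fun j => c j * s' j + s j * c' j).
Proof.
rewrite /rotation_mx mulmx_block !(mulmxN, mulNmx) !mulmx_diag -!linearN -!linearD /=.
by congr (block_mx (diag_mx _) (diag_mx _) (diag_mx _) (diag_mx _));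
  apply/rowP => j; rewrite !mxE; ring.
Qed.

Lemma cvg_rotation_mx {K : numFieldType} {n : nat} (c s : nat -> 'I_n -> K) (c' s' : 'I_n -> K) :
  (forall j, c k j @[k --> \oo] --> c' j)%classic ->
  (forall j, s k j @[k --> \oo] --> s' j)%classic ->
  (rotation_mx (c k) (s k) @[k --> \oo] --> rotation_mx c' s')%classic.
Proof.
move=> cc ss.
(* Entries of [diag_mx] have the form [x *+ (i == j)]; this covers both the diagonal and the
   zeros. *)
have cvgMb (u : nat -> K) l (b : bool) : (u k @[k --> \oo] --> l)%classic ->
    (u k *+ b @[k --> \oo] --> l *+ b)%classic.
  by case: b => // _; exact: cvg_cst.
apply: cvg_mx => i j; rewrite -(fintype.splitK i) -(fintype.splitK j).
case: (fintype.split i) => i'; case: (fintype.split j) => j' /=; under eq_fun do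
  rewrite ?(block_mxEul, block_mxEur, block_mxEdl, block_mxEdr) !mxE;
  rewrite ?(block_mxEul, block_mxEur, block_mxEdl, block_mxEdr) !mxE.
- exact: cvgMb.
- exact: cvgMb.
- by apply: cvgN; exact: cvgMb.
- exact: cvgMb.
Qed.

(** Conjugation by [S] turns each term of the series into the block matrix of the cosine and sine
    coefficients, and passes to partial sums and, by continuity of the product, to the limit. *)
Lemma expmx_rotation {R : realType} {n : nat} (X S : 'M[R]_(n + n)) (lam : 'I_n -> R) (t : R) :
  S \in unitmx -> X *m S = S *m rotation_mx (fun=> 0) lam ->
  expmx (t *: X) =
  S *m rotation_mx (fun j => cos (lam j * t)) (fun j => sin (lam j * t)) *m invmx S.
Proof.
move=> uS XS.
pose c k j := cos_coeff (lam j * t) k; pose s k j := sin_coeff (lam j * t) k.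
have pow k : k`!%:R^-1 *: (t *: X) ^+ k *m S = S *m rotation_mx (c k) (s k).
  (* [c'] and [s'] are the real and imaginary parts of [(i lam_j t)^k], shaped like [cos_coeff] and
     [sin_coeff] without the factorial. *)
  pose c' k (j : 'I_n) : R := (~~ odd k)%:R * (-1) ^+ k./2 * (lam j * t) ^+ k.
  pose s' k (j : 'I_n) : R := (odd k)%:R * (-1) ^+ k.-1./2 * (lam j * t) ^+ k.
  have pow' : (t *: X) ^+ k *m S = S *m rotation_mx (c' k) (s' k).
    elim: k => [|k IHk].
      have -> : c' 0%N = fun=> 1 by apply/funext => j; rewrite /c' /= !mulr1.
      have -> : s' 0%N = fun=> 0 by apply/funext => j; rewrite /s' /= !mul0r.
      rewrite expr0 mul1mx -[LHS]mulmx1 scalar_mx_block /rotation_mx.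
      by congr (_ *m block_mx _ _ _ _); apply/matrixP => i j; rewrite !mxE // mul0rn ?oppr0.
    rewrite exprSr -mulmxE -mulmxA -scalemxAl XS scalemxAr mulmxA IHk -mulmxA; congr (_ *m _).
    rewrite rotation_mxZ rotation_mxM; congr rotation_mx; apply/funext => j.
      rewrite /c' /s' mulr0 mulr0 sub0r exprS /= negbK.
      (* The predecessor in [s'] truncates at [k = 0], where the parity factors make both sides
         zero. *)
      case: k {IHk} => [|k] /=; first by rewrite !mul0r oppr0.
      by case: (odd k); rewrite /= ?exprS; ring.
    by rewrite /c' /s' mulr0 mulr0 addr0 exprS /=; ring.
  rewrite -scalemxAl pow' scalemxAr rotation_mxZ.
  by congr (_ *m rotation_mx _ _); apply/funext => j; rewrite mulrC.
apply: cvg_lim; first exact: norm_hausdorff.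
have seriesE N : series (fun k => k`!%:R^-1 *: (t *: X) ^+ k) N = S *m
    rotation_mx (fun j => series (cos_coeff (lam j * t)) N)
      (fun j => series (sin_coeff (lam j * t)) N) *m invmx S.
  elim: N => [|N IHN].
    have series0 (V : zmodType) (u : nat -> V) : series u 0%N = 0.
      by rewrite seriesEnat /= big_geq.
    rewrite series0 (_ : rotation_mx _ _ = 0) ?mulmx0 ?mul0mx //.
    rewrite /rotation_mx -block_mx0.
    by congr block_mx; apply/matrixP => i j; rewrite !mxE series0 mul0rn ?oppr0.
  rewrite seriesSr IHN -[_ *: _](mulmxK uS) pow -mulmxDl -mulmxDr rotation_mxD.
  by congr (_ *m rotation_mx _ _ *m _); apply/funext => j; rewrite seriesSr.
rewrite (funext seriesE); apply: cvg_mulmx; last exact: cvg_cst.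
apply: cvg_mulmx; first exact: cvg_cst.
(* Unlocking exposes [cos] and [sin] as the limits of these series. *)
apply: cvg_rotation_mx => j; rewrite unlock.
- exact: is_cvg_series_cos_coeff.
- exact: is_cvg_series_sin_coeff.
Qed.

Theorem lemma4p2 (R : realType) (n : nat) (M : 'M[R]_(n + n))
    (hM : sym_posdef M) :
  (exists (lam : 'I_n -> R) (e f : 'I_n -> 'cV[R]_(n + n)),
     [/\ forall j, 0 < lam j,
         spectrum_pm_i (Jmx R n *m M) lam,
         pm_i_eigenvectors (Jmx R n *m M) lam e f &
         symplectic_basis e f]) /\
  (forall (lam : 'I_n -> R) (e f : 'I_n -> 'cV[R]_(n + n)),
     (forall j, 0 < lam j) ->
     pm_i_eigenvectors (Jmx R n *m M) lam e f ->
     symplectic_basis e f ->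
     let S := cols_mx e f in
     S \in Sp R n /\
     forall t : R,
       let Theta := diag_mx (\row_j sin (lam j * t)) in
       let Omega := diag_mx (\row_j cos (lam j * t)) in
       expmx (t *: (Jmx R n *m M)) =
         Jmx R n *m (invmx S)^T *m block_mx Theta (- Omega) Omega Theta
           *m invmx S).
Proof.
split=> [|lam e f _ /pm_i_eigenvectorsP hX [_ ee ff ef] S].
  have [lam [e [f [lam0 hX ee ff ef]]]] := williamson_frame M hM.
  exists lam, e, f; split=> //; [|exact/pm_i_eigenvectorsP|exact: frame_basis].
  move=> mu; have uS := frame_unit _ _ ee ff ef.
  (* The intertwining relation, mapped to the complex numbers, transfers the spectrum to the
     antidiagonal matrix. *)
  rewrite (eigenvalue_similar _
    (block_mx 0 (diag_mx (\row_j (lam j)%:C%C)) (- diag_mx (\row_j (lam j)%:C%C)) 0)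
    (cplx_mx (cols_mx e f))); first last.
  - rewrite /cplx_mx -map_mxM (frame_intertwines _ _ _ _ hX) map_mxM; congr (_ *m _).
    rewrite map_block_mx !map_mx0 map_mxN map_diag_mx.
    by congr (block_mx _ (diag_mx _) (- diag_mx _) _); apply/rowP => j; rewrite !mxE.
  - by rewrite /cplx_mx map_unitmx.
  have mu2 j : (mu ^+ 2 = - (lam j)%:C%C ^+ 2) <->
      mu = 'i * (lam j)%:C%C \/ mu = - ('i * (lam j)%:C%C).
    have -> : - (lam j)%:C%C ^+ 2 = ('i * (lam j)%:C%C) ^+ 2 by rewrite exprMn sqrCi mulN1r.
    split=> [/eqP|[] ->]; rewrite ?sqrrN //.
    by rewrite eqf_sqr => /orP[] /eqP; [left | right].
  rewrite eigenvalue_antidiag => [|j].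
    by split=> -[j /mu2]; exists j.
  by rewrite fmorph_eq0 gt_eqF.
have uS := frame_unit _ _ ee ff ef; split; first by rewrite inE; apply/eqP/frame_symplectic.
move=> t Theta Omega.
rewrite (expmx_rotation _ _ lam t uS); last first.
  rewrite (frame_intertwines _ _ _ _ hX); congr (_ *m block_mx _ _ _ _);
    by apply/matrixP => i j; rewrite !mxE mul0rn.
(* [S J] replaces [J S^-T], and [J] times the block matrix of the statement is the rotation block
   with cosine part [Omega] and sine part [Theta]. *)
rewrite frame_J_inv_tr // -[S *m _ *m block_mx _ _ _ _]mulmxA; congr (_ *m _ *m _).
by rewrite /Jmx mulmx_block !mul0mx !mulNmx !mul1mx !add0r !addr0 opprK.
Qed.
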